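(* Let $G$ be a finitely generated group and $X$ any finite symmetric generating set. Let $Z$ be a (possibly infinite) generating set of $G$ and let $H$ be a finitely generated subgroup of $G$ which is quasi-isometrically embedded in $(G,d_Z)$. Suppose the action of $G$ on the Cayley graph $\Gamma(G,Z)$ is acylindrical and $\Gamma(G,Z)$ is hyperbolic. Then $(G,X)$ has BCD relative to $H$, i.e. there is $K\ge 0$ such that for every word $U$ over $X$ that has minimal length among all words representing elements of the $G$-conjugacy class of the element it represents, and that represents an element conjugate into $H$, there exist $g\in G$ with $|g|_X\le K$ and a cyclic permutation $U'$ of $U$ such that $gU'g^{-1}\in H$.
   Context: Generating sets generate $G$ as a monoid and are closed under inverses; $G$ acts on $\Gamma(G,Z)$ by left multiplication. An isometric action on a metric space $(S,d)$ is acylindrical if for every $\epsilon>0$ there exist $R,N\ge0$ such that for all $x,y\in S$ with $d(x,y)\ge R$ at most $N$ elements $g$ satisfy $d(x,gx)\le\epsilon$ and $d(y,gy)\le\epsilon$. A cyclic permutation of a word is a cyclic shift of its letters. *)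

(* Defs.v *)
From Stdlib Require Import List ZArith ClassicalEpsilon.
Import ListNotations.

Record Group := {
  gcar :> Type;
  gmul : gcar -> gcar -> gcar;
  gone : gcar;
  ginv : gcar -> gcar;
  gmulA : forall a b c, gmul a (gmul b c) = gmul (gmul a b) c;
  gmul1g : forall a, gmul gone a = a;
  gmulVg : forall a, gmul (ginv a) a = gone
}.

Arguments gmul {g}. Arguments gone {g}. Arguments ginv {g}.

Section Words.
Variable G : Group.

Definition eval (w : list G) : G := fold_right gmul gone w.

Definition word_over (S : G -> Prop) (w : list G) : Prop := Forall S w.

Definition gen_set (S : G -> Prop) : Prop :=
  (forall s, S s -> S (ginv s)) /\
  (forall g : G, exists w, word_over S w /\ eval w = g).

Definition wlen_le (S : G -> Prop) (g : G) (n : nat) : Prop :=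
  exists w, word_over S w /\ eval w = g /\ length w <= n.

(* word length |g|_S (the minimum; meaningful when S generates) *)
Definition wlen (S : G -> Prop) (g : G) : nat :=
  epsilon (inhabits 0%nat)
    (fun n => wlen_le S g n /\ forall m, wlen_le S g m -> n <= m).

(* word metric d_S(g,h) = |g^{-1} h|_S, i.e. the graph metric on the
   vertex set of the Cayley graph Gamma(G,S) *)
Definition dist (S : G -> Prop) (g h : G) : nat := wlen S (gmul (ginv g) h).

(* Gromov hyperbolicity of Gamma(G,S) via the four-point condition on
   vertices, with doubled Gromov products:
   2 (x|y)_w = d(x,w) + d(y,w) - d(x,y). *)
Definition gprod2 (S : G -> Prop) (x y w : G) : Z :=
  (Z.of_nat (dist S x w) + Z.of_nat (dist S y w) - Z.of_nat (dist S x y))%Z.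

Definition cayley_hyperbolic (S : G -> Prop) : Prop :=
  exists delta : nat, forall x y z w : G,
    (Z.min (gprod2 S x y w) (gprod2 S y z w) - 2 * Z.of_nat delta
       <= gprod2 S x z w)%Z.

Definition acylindrical (S : G -> Prop) : Prop :=
  forall eps : nat, exists R N : nat, forall x y : G,
    R <= dist S x y ->
    forall l : list G, NoDup l ->
      Forall (fun g => dist S x (gmul g x) <= eps /\
                       dist S y (gmul g y) <= eps) l ->
      length l <= N.

Definition subgroup (H : G -> Prop) : Prop :=
  H gone /\ (forall a b, H a -> H b -> H (gmul a b)) /\
  (forall a, H a -> H (ginv a)).

Definition fin_gen_subgroup (H : G -> Prop) (X : list G) : Prop :=
  (forall x, In x X -> H x) /\
  (forall x, In x X -> In (ginv x) X) /\
  (forall h, H h -> exists w, word_over (fun x => In x X) w /\ eval w = h).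

(* H is quasi-isometrically embedded in (G, d_Z), with respect to a word
   metric d_S on H given by a finite generating set S of H *)
Definition qi_embedded (H : G -> Prop) (S : list G) (Z0 : G -> Prop) : Prop :=
  exists lam c : nat, forall h h' : G, H h -> H h' ->
    dist (fun x => In x S) h h' <= lam * dist Z0 h h' + c /\
    dist Z0 h h' <= lam * dist (fun x => In x S) h h' + c.

Definition conj (c u : G) : G := gmul (gmul c u) (ginv c).

Definition cyclic_perm (U U' : list G) : Prop :=
  exists i, U' = skipn i U ++ firstn i U.

Definition cyc_minimal (X : list G) (U : list G) : Prop :=
  forall V, word_over (fun x => In x X) V ->
    (exists c, eval V = conj c (eval U)) -> length U <= length V.

Definition BCD_rel (X : list G) (H : G -> Prop) : Prop :=
  exists K : nat, forall U : list G,
    word_over (fun x => In x X) U ->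
    cyc_minimal X U ->
    (exists c, H (conj c (eval U))) ->
    exists (g : G) (U' : list G),
      wlen_le (fun x => In x X) g K /\ cyclic_perm U U' /\ H (conj g (eval U')).

End Words.

(* Main.v *)
(** Write [h = c u c^-1] in [H] for the element [u] of [U], and follow the line
    [y_i = c * (prefix of U of length i)] from [c] to [h c] in [Gamma(G,Z)],
    together with a nearest-point projection [p_i] of [y_i] to [H].  As [H] is
    quasi-convex in a hyperbolic space, the projection is strongly contracting,
    so the line advances along [H] arbitrarily slowly, relative to its length,
    while it stays far from [H].  On the other hand [p_0^-1 h p_0] is conjugate
    to [u], so minimality bounds [|U|] linearly by [d_Z(p_0, h p_0)], i.e. the
    line advances along [H] at a definite speed.  Hence, if [U] is long, some
    subpath of bounded [X]-length has both ends [r]-close to [H] and projects to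
    two distant points of [H].  Acylindricity leaves only finitely many
    possibilities for [p_i^-1 y_i] at the start of such a subpath, and this
    element conjugates the cyclic permutation of [U] starting at [i] into [H]. *)
Require Import Defs.
From Stdlib Require Import List Lia ClassicalEpsilon ZArith.
Import ListNotations.

(** * Logarithmic bounds and extremal choices in the natural numbers *)

Lemma pow2_le_affine_bound (p q : nat) :
  exists k0, forall k, 2 ^ k <= p * k + q -> k <= k0.
Proof.
  assert (Hsq : forall k, 4 <= k -> k * k <= 2 ^ k).
  { induction k as [|k IH]; intros Hk; [lia|].
    destruct (Nat.eq_dec k 3) as [->|]; [simpl; lia|].
    specialize (IH ltac:(lia)). rewrite Nat.pow_succ_r'. nia. }
  exists (p + q + 4). intros k Hk.
  destruct (le_lt_dec k (p + q + 4)) as [|Hlt]; [assumption|exfalso].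
  specialize (Hsq k ltac:(lia)). nia.
Qed.

Lemma le_pow2_log2_up (n : nat) : n <= 2 ^ Nat.log2_up n.
Proof.
  destruct (le_lt_dec n 1) as [Hn|Hn].
  - rewrite (Nat.log2_up_eqn0 n Hn). simpl. lia.
  - apply Nat.log2_up_spec, Hn.
Qed.

(** For [k] the logarithm, [2 ^ (k - 1) < e * D + f <= e * (a + b * k) + f]: an exponential is below
    an affine function of [k], so [k], and with it [D], is bounded. This ends the proof of
    quasi-convexity. *)
Lemma le_affine_log2_bound (a b e f : nat) :
  exists D0, forall D, D <= a + b * Nat.log2_up (e * D + f) -> D <= D0.
Proof.
  destruct (pow2_le_affine_bound (2 * e * b) (2 * (e * a + f))) as [k0 Hk0].
  exists (a + b * k0). intros D HD.
  set (k := Nat.log2_up (e * D + f)) in *.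
  assert (k <= k0); [|nia].
  destruct (le_lt_dec (e * D + f) 1) as [Hn|Hn].
  - unfold k. rewrite (Nat.log2_up_eqn0 _ Hn). lia.
  - apply Hk0. destruct (Nat.log2_up_spec _ Hn) as [Hlow _]. fold k in Hlow.
    destruct k as [|k']; [simpl; nia|].
    rewrite Nat.pow_succ_r'. simpl pred in Hlow. nia.
Qed.

Lemma nat_argmin (A : Type) (P : A -> Prop) (f : A -> nat) :
  (exists x, P x) -> exists x, P x /\ forall y, P y -> f x <= f y.
Proof.
  intros [x Hx].
  assert (Hind : forall n x, P x -> f x <= n ->
            exists x, P x /\ forall y, P y -> f x <= f y).
  { induction n as [|n IH]; intros z Hz Hfz.
    - exists z. split; [assumption|]. intros. lia.
    - destruct (classic (exists y, P y /\ f y <= n)) as [[y [Hy Hfy]]|Hno].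
      + exact (IH y Hy Hfy).
      + exists z. split; [assumption|]. intros y Hy.
        destruct (le_lt_dec (f z) (f y)); [assumption|].
        exfalso. apply Hno. exists y. split; [assumption|lia]. }
  exact (Hind (f x) x Hx (le_n _)).
Qed.

Lemma nat_argmax (A : Type) (P : A -> Prop) (f : A -> nat) (b : nat) :
  (exists x, P x) -> (forall x, P x -> f x <= b) ->
  exists x, P x /\ forall y, P y -> f y <= f x.
Proof.
  intros Hex Hb.
  destruct (nat_argmin A P (fun x => b - f x) Hex) as [x [Hx Hmin]].
  exists x. split; [assumption|]. intros y Hy.
  specialize (Hmin y Hy). pose proof (Hb x Hx). specialize (Hb y Hy). lia.
Qed.

Lemma first_or_none (P : nat -> Prop) (n : nat) :
  (forall i, i < n -> ~ P i) \/
  exists i, i < n /\ P i /\ forall j, j < i -> ~ P j.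
Proof.
  destruct (classic (exists i, i < n /\ P i)) as [Hex|Hno].
  - right. destruct (nat_argmin nat _ (fun i => i) Hex) as [i [[Hi HPi] Hmin]].
    exists i. repeat split; try assumption. intros j Hj HPj.
    specialize (Hmin j (Logic.conj (Nat.lt_trans _ _ _ Hj Hi) HPj)). lia.
  - left. intros i Hi HPi. apply Hno. exists i. split; assumption.
Qed.

Lemma last_or_none (P : nat -> Prop) (n : nat) :
  (forall i, i < n -> ~ P i) \/
  exists i, i < n /\ P i /\ forall j, i < j -> j < n -> ~ P j.
Proof.
  destruct (classic (exists i, i < n /\ P i)) as [Hex|Hno].
  - right. destruct (nat_argmax nat _ (fun i => i) n Hex) as [i [[Hi HPi] Hmax]];
      [intros; lia|].
    exists i. repeat split; try assumption. intros j Hj Hjn HPj.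
    specialize (Hmax j (Logic.conj Hjn HPj)). lia.
  - left. intros i Hi HPi. apply Hno. exists i. split; assumption.
Qed.

(** * Projection to a quasi-convex subset of a hyperbolic space *)

Section HyperbolicSpace.
Variables (A : Type) (d : A -> A -> nat) (delta : nat).
Hypothesis d_refl : forall x, d x x = 0.
Hypothesis d_sym : forall x y, d x y = d y x.
Hypothesis d_triangle : forall x y z, d x z <= d x y + d y z.
Hypothesis d_geodesic : forall x y k, k <= d x y ->
  exists m, d x m = k /\ d m y = d x y - k.
Hypothesis d_four_point : forall x y z w,
  d x z + d y w <= Nat.max (d x y + d z w) (d y z + d x w) + 2 * delta.

(* The doubled Gromov product of the two ends loses only [2 * delta] at each of the [k] halvings. *)
Lemma gromov_product_path (w : A) (D kappa : nat) (x : nat -> A) :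
  (forall i, D <= d (x i) w) -> (forall i, d (x i) (x (S i)) <= kappa) ->
  forall k a n M, n <= 2 ^ k -> M + 2 * delta * k + kappa <= 2 * D ->
    M + d (x a) (x (a + n)) <= d (x a) w + d (x (a + n)) w.
Proof.
  intros HD Hstep. induction k as [|k IH]; intros a n M Hn HM.
  - pose proof (HD a). pose proof (HD (a + n)).
    assert (d (x a) (x (a + n)) <= kappa); [|lia].
    simpl in Hn. destruct n as [|[|n]]; [| |lia].
    + rewrite Nat.add_0_r, d_refl. lia.
    + rewrite Nat.add_1_r. apply Hstep.
  - rewrite Nat.pow_succ_r' in Hn.
    set (n1 := Nat.min n (2 ^ k)).
    pose proof (IH a n1 (M + 2 * delta) ltac:(lia) ltac:(lia)) as H1.
    pose proof (IH (a + n1) (n - n1) (M + 2 * delta) ltac:(lia) ltac:(lia)) as H2.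
    replace (a + n1 + (n - n1)) with (a + n) in H2 by lia.
    pose proof (d_four_point (x a) (x (a + n1)) (x (a + n)) w). lia.
Qed.

Variable H : A -> Prop.
Hypothesis H_inhabited : exists h, H h.

Definition nearest (y p : A) : Prop := H p /\ forall h, H h -> d y p <= d y h.

Lemma nearest_exists (y : A) : exists p, nearest y p.
Proof. exact (nat_argmin A H (d y) H_inhabited). Qed.

(** A discrete stand-in for quasi-geodesics inside [H]: chains with bounded jumps whose number of
    jumps is linear in the ambient distance. *)
Definition coarsely_embedded (lam c kappa : nat) : Prop :=
  forall h h', H h -> H h' ->
    exists n x, n <= lam * d h h' + c /\ x 0 = h /\ x n = h' /\
      (forall i, H (x i)) /\ (forall i, d (x i) (x (S i)) <= kappa).

Definition between (p w q : A) : Prop := d p w + d w q = d p q.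

(* One side of the detour around a point [w] of the geodesic from [p] to [q]
   whose distance [D] to [H] is maximal. *)
Lemma detour_side (p q w : A) (D : nat) :
  H p -> between p w q ->
  (forall h, H h -> D <= d w h) ->
  (forall v, between p v q -> exists h, H h /\ d v h <= D) ->
  exists u u', H u' /\ d u u' <= D /\ d u w <= 2 * D /\
    d p u + d u w = d p w /\ 2 * D + d u u' <= d u w + d u' w.
Proof.
  intros Hp Hw HD Hmax. unfold between in *.
  (* The detour leaves the geodesic [2 * D] before [w], or at [p] if [p] is nearer than that. The
     last conclusion says that the Gromov product of [u] and [u'] at [w] is at least [D]. *)
  destruct (le_lt_dec (d p w) (2 * D)) as [Hle|Hlt].
  - exists p, p. rewrite d_refl. pose proof (HD p Hp). rewrite (d_sym w p) in *.
    repeat split; solve [assumption | lia].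
  - destruct (d_geodesic p w (d p w - 2 * D) ltac:(lia)) as [u [Hu1 Hu2]].
    destruct (Hmax u) as [u' [Hu' Hd]].
    { pose proof (d_triangle p u q). pose proof (d_triangle u w q). lia. }
    exists u, u'. pose proof (HD u' Hu'). rewrite (d_sym w u') in *.
    repeat split; solve [assumption | lia].
Qed.

(** Let [m] be a point of the geodesic at maximal distance [D] from [H]. A detour around [m] through
    [H] takes linearly many steps in [D] and never comes nearer to [m] than [D]. Hyperbolicity lets
    such a detour join opposite sides of [m] only if [D] is at most logarithmic in its number of
    steps. *)
Lemma quasiconvex (lam c kappa : nat) :
  coarsely_embedded lam c kappa ->
  exists Q, forall p q w, H p -> H q -> between p w q ->
    exists h, H h /\ d w h <= Q.
Proof.
  intros Hemb.
  destruct (le_affine_log2_bound (4 * delta + kappa) (2 * delta) (6 * lam) c)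
    as [Q HQ].
  exists Q. intros p q w Hp Hq Hw.
  (* The maximum runs over pairs of a point and a nearest point of [H]; it exists since [p] in [H]
     bounds these distances by [d p q]. *)
  destruct (nat_argmax (A * A) (fun wh => between p (fst wh) q /\ nearest (fst wh) (snd wh))
              (fun wh => d (fst wh) (snd wh)) (d p q)) as [[m hm] [[Hm Hnear] Hmax]].
  { destruct (nearest_exists w) as [h Hh]. exists (w, h). split; assumption. }
  { intros [v h] [Hv [_ Hmin]]. simpl in *. specialize (Hmin p Hp).
    unfold between in Hv. rewrite (d_sym v p) in *. lia. }
  simpl in *. set (D := d m hm) in *.
  assert (HmaxD : forall v, between p v q -> exists h, H h /\ d v h <= D).
  { intros v Hv. destruct (nearest_exists v) as [h Hh]. exists h.
    split; [apply Hh|]. exact (Hmax (v, h) (Logic.conj Hv Hh)). }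
  enough (HDQ : D <= Q).
  { destruct (HmaxD w Hw) as [h [Hh Hd]]. exists h. split; [assumption|lia]. }
  assert (Hfar : forall h, H h -> D <= d m h) by apply Hnear.
  assert (Hflip : forall a v b, between a v b -> between b v a).
  { unfold between. intros a v b Hv.
    rewrite (d_sym b v), (d_sym v a), (d_sym b a). lia. }
  destruct (detour_side p q m D Hp Hm Hfar HmaxD)
    as (u & u' & Hu' & Huu' & Hum & Hpu & Hgu).
  destruct (detour_side q p m D Hq (Hflip _ _ _ Hm) Hfar)
    as (v & v' & Hv' & Hvv' & Hvm & Hqv & Hgv).
  { intros z Hz. apply HmaxD, Hflip, Hz. }
  assert (Huv : d u m + d v m <= d u v).
  { unfold between in Hm.
    pose proof (d_triangle p u q). pose proof (d_triangle u v q).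
    rewrite (d_sym q v), (d_sym q m) in *. lia. }
  destruct (Hemb u' v' Hu' Hv') as (n & x & Hn & Hx0 & Hxn & HxH & Hxs).
  assert (Huv' : d u' v' <= 6 * D).
  { pose proof (d_triangle u' u v'). pose proof (d_triangle u m v').
    pose proof (d_triangle m v v'). rewrite (d_sym u' u), (d_sym m v) in *. lia. }
  set (k := Nat.log2_up (6 * lam * D + c)).
  assert (Hnk : n <= 2 ^ k).
  { pose proof (le_pow2_log2_up (6 * lam * D + c)) as Hlog. fold k in Hlog. nia. }
  apply HQ. fold k.
  destruct (le_lt_dec D (4 * delta + kappa + 2 * delta * k)) as [|Hlt]; [assumption|exfalso].
  assert (HxD : forall i, D <= d (x i) m).
  { intros i. rewrite d_sym. apply Hfar, HxH. }
  (* Going from [u] through [u'] and [v'] to [v] uses the four-point condition twice and costs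
     [4 * delta], so [4 * delta + 1] leaves a positive product of [u] and [v] at [m]. But [m] lies
     between them, so that product is zero. *)
  pose proof (gromov_product_path m D kappa x HxD Hxs k 0 n (4 * delta + 1) Hnk
                ltac:(lia)) as Hpath.
  simpl in Hpath. rewrite Hx0, Hxn in Hpath.
  pose proof (d_four_point u u' v' m). pose proof (d_four_point u v' v m).
  rewrite (d_sym v' v) in *. lia.
Qed.

(** By truncated subtraction, the projection moves at most [B] while [y'] stays in the ball around
    [y] of radius [d y p]; beyond it only the excess is added. *)
Definition contracting (B : nat) : Prop :=
  forall y y' p p', nearest y p -> nearest y' p' -> d p p' <= B + (d y y' - d y p).

(** Let [t] be the Gromov product of [y] and [q] at [p], rounded down. The point [m] at distance [t]
    from [p] towards [q] is about [t] nearer to [y] than [p] is, yet [Q]-close to [H]; as [p] is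
    nearest, [t <= Q + 2 * delta]. The final 1 pays for the rounding. *)
Lemma nearest_almost_on_geodesic (Q : nat) :
  (forall p q w, H p -> H q -> between p w q -> exists h, H h /\ d w h <= Q) ->
  forall y p q, nearest y p -> H q ->
    d y p + d p q <= d y q + 2 * Q + 4 * delta + 1.
Proof.
  intros HQ y p q [Hp Hmin] Hq.
  pose proof (d_triangle y q p). pose proof (d_triangle y p q).
  rewrite (d_sym q p) in *.
  set (t := (d y p + d p q - d y q) / 2).
  assert (Ht : 2 * t <= d y p + d p q - d y q < 2 * t + 2).
  { unfold t. pose proof (Nat.div_mod_eq (d y p + d p q - d y q) 2).
    pose proof (Nat.mod_upper_bound (d y p + d p q - d y q) 2). lia. }
  destruct (d_geodesic p q t ltac:(lia)) as [m [Hm1 Hm2]].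
  destruct (HQ p q m Hp Hq) as [h [Hh Hmh]]; [unfold between; lia|].
  specialize (Hmin h Hh). pose proof (d_triangle y m h).
  pose proof (d_four_point y q m p).
  rewrite (d_sym q p), (d_sym m p), (d_sym q m) in *. lia.
Qed.

(** The paths from [y] to [p'] and from [y'] to [p] almost pass through [p] and [p'] respectively;
    adding both estimates and applying the four-point condition to the quadrilateral gives [B]. *)
Lemma coarsely_embedded_contracting (lam c kappa : nat) :
  coarsely_embedded lam c kappa -> exists B, contracting B.
Proof.
  intros Hemb. destruct (quasiconvex lam c kappa Hemb) as [Q HQ].
  exists (4 * Q + 10 * delta + 2). intros y y' p p' Hy Hy'.
  pose proof (nearest_almost_on_geodesic Q HQ y p p' Hy (proj1 Hy')).
  pose proof (nearest_almost_on_geodesic Q HQ y' p' p Hy' (proj1 Hy)).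
  pose proof (d_four_point y y' p' p).
  rewrite (d_sym p' p) in *. lia.
Qed.

(** * Progress of the projection of a path *)

Section PathProjection.
Variables (B kappa : nat) (y p : nat -> A).
Hypothesis B_contracting : contracting B.
Hypothesis y_step : forall i, d (y i) (y (S i)) <= kappa.
Hypothesis p_nearest : forall i, nearest (y i) (p i).

Lemma path_dist_le (a n : nat) : d (y a) (y (a + n)) <= kappa * n.
Proof.
  induction n as [|n IH].
  - rewrite Nat.add_0_r, d_refl. lia.
  - pose proof (d_triangle (y a) (y (a + n)) (y (S (a + n)))).
    pose proof (y_step (a + n)). rewrite Nat.add_succ_r. lia.
Qed.

Lemma projection_dist_le (a n : nat) : d (p a) (p (a + n)) <= B + kappa * n.
Proof.
  pose proof (B_contracting _ _ _ _ (p_nearest a) (p_nearest (a + n))).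
  pose proof (path_dist_le a n). lia.
Qed.

(* While [y] stays [r]-far from [H], each block of [q] steps has length at most [r],
   so its projection advances by at most [B]. *)
Lemma far_projection_slow (q r : nat) :
  1 <= q -> kappa * q <= r ->
  forall n a, (forall i, i < n -> r <= d (y (a + i)) (p (a + i))) ->
    q * d (p a) (p (a + n)) <= B * (n + q).
Proof.
  intros Hq Hr. induction n as [n IH] using lt_wf_ind. intros a Hfar.
  destruct (Nat.eq_dec n 0) as [->|Hn].
  { rewrite Nat.add_0_r, d_refl. lia. }
  assert (Hblock : forall l, l <= q -> d (p a) (p (a + l)) <= B).
  { intros l Hl.
    pose proof (B_contracting _ _ _ _ (p_nearest a) (p_nearest (a + l))).
    pose proof (path_dist_le a l). specialize (Hfar 0 ltac:(lia)).
    rewrite Nat.add_0_r in Hfar. nia. }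
  destruct (le_lt_dec n q) as [Hle|Hlt].
  - specialize (Hblock n Hle). nia.
  - specialize (Hblock q (le_n _)).
    assert (Hrest : q * d (p (a + q)) (p (a + q + (n - q))) <= B * (n - q + q)).
    { apply IH; [lia|]. intros i Hi.
      replace (a + q + i) with (a + (q + i)) by lia. apply Hfar. lia. }
    replace (a + q + (n - q)) with (a + n) in Hrest by lia.
    pose proof (d_triangle (p a) (p (a + q)) (p (a + n))). nia.
Qed.

(** The first and last [r]-close times cut the window into two far stretches, each advancing slowly,
    a middle part advancing at most [R], and one step after the last close time, which costs
    [B + kappa]. *)
Lemma window_projection_slow (q r R W a : nat) :
  1 <= q -> kappa * q <= r ->
  (forall i j, i <= j <= i + W -> d (y i) (p i) <= r -> d (y j) (p j) <= r ->
     d (p i) (p j) <= R) ->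
  q * d (p a) (p (a + W)) <= 2 * B * W + (3 * B + kappa + R) * q.
Proof.
  intros Hq Hr Hclose.
  set (P := fun i => d (y (a + i)) (p (a + i)) <= r).
  destruct (first_or_none P W) as [Hnone|(i & Hi & HPi & Hfirst)].
  { pose proof (far_projection_slow q r Hq Hr W a) as Hslow.
    assert (q * d (p a) (p (a + W)) <= B * (W + q)); [|nia].
    apply Hslow. intros k Hk. specialize (Hnone k Hk). unfold P in Hnone. lia. }
  destruct (last_or_none P W) as [Hnone|(j & Hj & HPj & Hlast)].
  { exfalso. exact (Hnone i Hi HPi). }
  assert (Hij : i <= j).
  { destruct (le_lt_dec i j); [assumption|]. exfalso. exact (Hlast i l Hi HPi). }
  assert (H1 : q * d (p a) (p (a + i)) <= B * (i + q)).
  { apply (far_projection_slow q r Hq Hr i a). intros k Hk.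
    specialize (Hfirst k Hk). unfold P in Hfirst. lia. }
  assert (H2 : d (p (a + i)) (p (a + j)) <= R).
  { apply Hclose; [lia|exact HPi|exact HPj]. }
  assert (H3 : q * d (p (a + S j)) (p (a + S j + (W - S j))) <= B * (W - S j + q)).
  { apply (far_projection_slow q r Hq Hr). intros k Hk.
    specialize (Hlast (S j + k) ltac:(lia) ltac:(lia)). unfold P in Hlast.
    replace (a + S j + k) with (a + (S j + k)) by lia. lia. }
  replace (a + S j + (W - S j)) with (a + W) in H3 by lia.
  pose proof (projection_dist_le (a + j) 1) as H4.
  replace (a + j + 1) with (a + S j) in H4 by lia.
  pose proof (d_triangle (p a) (p (a + i)) (p (a + W))) as T1.
  pose proof (d_triangle (p (a + i)) (p (a + j)) (p (a + W))) as T2.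
  pose proof (d_triangle (p (a + j)) (p (a + S j)) (p (a + W))) as T3.
  set (d1 := d (p a) (p (a + i))) in *.
  set (d3 := d (p (a + S j)) (p (a + W))) in *.
  assert (Htot : d (p a) (p (a + W)) <= d1 + (R + (B + kappa) + d3)) by lia.
  assert (B * (i + q) <= B * (W + q)) by (apply Nat.mul_le_mono_l; lia).
  assert (B * (W - S j + q) <= B * (W + q)) by (apply Nat.mul_le_mono_l; lia).
  apply (Nat.mul_le_mono_l _ _ q) in Htot. lia.
Qed.

Lemma windows_projection_slow (q E W : nat) :
  (forall a, q * d (p a) (p (a + W)) <= E) ->
  forall m, q * d (p 0) (p (m * W)) <= m * E.
Proof.
  intros HE. induction m as [|m IH].
  - simpl. rewrite d_refl. lia.
  - specialize (HE (m * W)).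
    replace (m * W + W) with (S m * W) in HE by lia.
    pose proof (d_triangle (p 0) (p (m * W)) (p (S m * W))). nia.
Qed.

End PathProjection.

(* [r] is chosen before [R], which acylindricity makes depend on [r]. *)
Lemma fast_path_comes_close (B kappa C : nat) :
  contracting B ->
  exists r, forall R c, exists W L0, forall y p : nat -> A,
    (forall i, d (y i) (y (S i)) <= kappa) ->
    (forall i, nearest (y i) (p i)) ->
    forall L, L0 < L -> L <= C * (d (p 0) (p L) + c) ->
    exists i j, i <= j <= i + W /\ d (y i) (p i) <= r /\ d (y j) (p j) <= r /\
      R < d (p i) (p j).
Proof.
  intros HB. set (q := 4 * B * C + 1). exists (kappa * q). intros R c.
  (* With this [W], [C] times the advance over a window is at most [W - 1]. Each window thus falls
     one step short of the assumed speed, and after [m0] windows the slack from [c] and from the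
     incomplete last window is used up. *)
  set (W := 2 * C * (3 * B + kappa + R) + 2).
  set (m0 := C * (B + kappa * W + c)).
  exists W, (S m0 * W). intros y p Hstep Hnear L HL0 HL.
  apply NNPP. intros Hno.
  set (E := 2 * B * W + (3 * B + kappa + R) * q).
  assert (HE : forall a, q * d (p a) (p (a + W)) <= E).
  { intros a. apply (window_projection_slow B kappa y p HB Hstep Hnear q (kappa * q));
      [unfold q; lia|lia|].
    intros i j Hij Hi Hj. destruct (le_lt_dec (d (p i) (p j)) R); [assumption|].
    exfalso. apply Hno. exists i, j. auto. }
  assert (HW : 0 < W) by (unfold W; lia).
  set (m := L / W). set (s := L mod W).
  assert (HLms : L = m * W + s).
  { unfold m, s. rewrite Nat.mul_comm. apply Nat.div_mod_eq. }
  assert (Hs : s < W) by (apply Nat.mod_upper_bound; lia).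
  pose proof (windows_projection_slow p q E W HE m) as Hm.
  pose proof (projection_dist_le B kappa y p HB Hstep Hnear (m * W) s) as Hrest.
  rewrite <- HLms in Hrest.
  pose proof (d_triangle (p 0) (p (m * W)) (p L)) as Htri.
  set (d0 := d (p 0) (p (m * W))) in *. set (dL := d (p 0) (p L)) in *.
  assert (HdL : dL + c <= d0 + (B + kappa * W + c)) by nia.
  assert (HqL : q * L <= C * (m * E) + q * m0).
  { unfold m0.
    assert (q * L <= q * (C * (d0 + (B + kappa * W + c)))) by (apply Nat.mul_le_mono_l; nia).
    assert (C * (q * d0) <= C * (m * E)) by (apply Nat.mul_le_mono_l; exact Hm). lia. }
  assert (HCE : 2 * (C * E) + 2 * q <= 2 * q * W).
  { assert (4 * B * C * W <= q * W) by (apply Nat.mul_le_mono_r; unfold q; lia).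
    assert (2 * C * (3 * B + kappa + R) * q + 2 * q = W * q) by (unfold W; lia).
    unfold E. lia. }
  assert (q * m <= q * m0).
  { assert (m * (2 * (C * E) + 2 * q) <= m * (2 * q * W)) by (apply Nat.mul_le_mono_l; exact HCE).
    assert (q * (m * W) <= q * L) by (apply Nat.mul_le_mono_l; lia). lia. }
  assert (m <= m0) by (unfold q in *; nia).
  pose proof (Nat.mul_le_mono_r m m0 W ltac:(assumption)). lia.
Qed.

End HyperbolicSpace.

(** * Word metrics *)

Section GroupFacts.
Variable G : Group.
Implicit Types a b c g h x y : G.

Lemma gmulKg a b : gmul (ginv a) (gmul a b) = b.
Proof. rewrite gmulA, gmulVg. apply gmul1g. Qed.

Lemma gmulgV a : gmul a (ginv a) = gone.
Proof.
  rewrite <- (gmulKg (ginv a) (gmul a (ginv a))), (gmulKg a). apply gmulVg.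
Qed.

Lemma gmulg1 a : gmul a gone = a.
Proof. rewrite <- (gmulVg G a), gmulA, gmulgV. apply gmul1g. Qed.

Lemma gmulKVg a b : gmul a (gmul (ginv a) b) = b.
Proof. rewrite gmulA, gmulgV. apply gmul1g. Qed.

Lemma ginv_unique a b : gmul a b = gone -> b = ginv a.
Proof. intros Hab. rewrite <- (gmulKg a b), Hab. apply gmulg1. Qed.

Lemma ginvK a : ginv (ginv a) = a.
Proof. symmetry. apply ginv_unique, gmulVg. Qed.

Lemma ginv1 : ginv (@gone G) = gone.
Proof. symmetry. apply ginv_unique, gmul1g. Qed.

Lemma ginvM a b : ginv (gmul a b) = gmul (ginv b) (ginv a).
Proof.
  symmetry. apply ginv_unique.
  rewrite <- gmulA, gmulKVg. apply gmulgV.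
Qed.

Lemma gmul_cancel_r a b c : gmul a c = gmul b c -> a = b.
Proof.
  intros E. rewrite <- (gmulg1 a), <- (gmulg1 b), <- (gmulgV c), !gmulA, E.
  reflexivity.
Qed.

End GroupFacts.

Ltac group_nf :=
  repeat first
    [ rewrite <- gmulA | rewrite ginvM | rewrite ginvK | rewrite ginv1
    | rewrite gmul1g | rewrite gmulg1 | rewrite gmulVg | rewrite gmulgV
    | rewrite gmulKg | rewrite gmulKVg ].

(** * Words, finiteness, and the geometry of word length *)

Lemma firstn_add (A : Type) (i n : nat) (w : list A) :
  firstn (i + n) w = firstn i w ++ firstn n (skipn i w).
Proof.
  revert w. induction i as [|i IH]; intros w; [reflexivity|].
  destruct w as [|x w]; simpl; [now rewrite firstn_nil|]. now rewrite IH.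
Qed.

Lemma words_of_bounded_length (A : Type) (X : list A) (n : nat) :
  exists l, forall w, Forall (fun x => In x X) w -> length w <= n -> In w l.
Proof.
  induction n as [|n [l Hl]].
  - exists [[]]. intros [|x w] _ Hlen; simpl in *; [auto|lia].
  - exists ([] :: flat_map (fun x => map (cons x) l) X).
    intros [|x w] Hw Hlen; [left; reflexivity|right].
    inversion Hw as [|x0 w0 Hx Hw0]; subst. simpl in Hlen.
    apply in_flat_map. exists x. split; [assumption|].
    apply in_map, Hl; [assumption|lia].
Qed.

Lemma list_uniform_bound (A : Type) (P : A -> nat -> Prop) (l : list A) :
  (forall x k k', k <= k' -> P x k -> P x k') ->
  (forall x, In x l -> exists k, P x k) ->
  exists k, forall x, In x l -> P x k.
Proof.
  intros Hmono. induction l as [|z l IH]; intros Hex.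
  - exists 0. intros x [].
  - destruct (Hex z (or_introl eq_refl)) as [k1 Hk1].
    destruct IH as [k2 Hk2]; [intros x Hx; apply Hex; right; assumption|].
    exists (Nat.max k1 k2). intros x [<-|Hx].
    + apply (Hmono _ k1); [lia|assumption].
    + apply (Hmono _ k2); [lia|auto].
Qed.

(** A longest repetition-free list of solutions is complete, since a missing solution could be put
    in front. *)
Lemma finite_of_bounded_NoDup (A : Type) (P : A -> Prop) (N : nat) :
  (forall l, NoDup l -> Forall P l -> length l <= N) ->
  exists l, forall x, P x -> In x l.
Proof.
  intros HN.
  destruct (nat_argmax (list A) (fun l => NoDup l /\ Forall P l) (@length A) N)
    as [l [[Hnd Hl] Hmax]].
  - exists []. split; constructor.
  - intros l [Hnd Hl]. exact (HN l Hnd Hl).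
  - exists l. intros x Hx. apply NNPP. intros Hnin.
    assert (Hlen : length (x :: l) <= length l).
    { apply Hmax. split; constructor; assumption. }
    simpl in Hlen. lia.
Qed.

Section WordMetric.
Variable G : Group.

Lemma eval_app (v w : list G) : eval G (v ++ w) = gmul (eval G v) (eval G w).
Proof.
  induction v as [|x v IH]; simpl; [now rewrite gmul1g|]. now rewrite IH, gmulA.
Qed.

Lemma eval_firstn_add (i n : nat) (w : list G) :
  eval G (firstn (i + n) w)
  = gmul (eval G (firstn i w)) (eval G (firstn n (skipn i w))).
Proof. now rewrite firstn_add, eval_app. Qed.

Lemma eval_rotation (i : nat) (w : list G) :
  gmul (eval G (firstn i w)) (eval G (skipn i w ++ firstn i w))
  = gmul (eval G w) (eval G (firstn i w)).
Proof.
  rewrite eval_app, gmulA, <- eval_app, firstn_skipn. reflexivity.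
Qed.

Lemma word_over_firstn (S : G -> Prop) (n : nat) (w : list G) :
  word_over G S w -> word_over G S (firstn n w).
Proof.
  unfold word_over. rewrite <- (firstn_skipn n w) at 1.
  rewrite Forall_app. intros [Hw _]. exact Hw.
Qed.

Lemma word_over_skipn (S : G -> Prop) (n : nat) (w : list G) :
  word_over G S w -> word_over G S (skipn n w).
Proof.
  unfold word_over. rewrite <- (firstn_skipn n w) at 1.
  rewrite Forall_app. intros [_ Hw]. exact Hw.
Qed.

Lemma wlen_le_mono (S : G -> Prop) (g : G) (m n : nat) :
  m <= n -> wlen_le G S g m -> wlen_le G S g n.
Proof. intros Hmn (w & Hw & He & Hl). exists w. repeat split; auto; lia. Qed.

Lemma wlen_spec (S : G -> Prop) (g : G) :
  (exists w, word_over G S w /\ eval G w = g) ->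
  wlen_le G S g (wlen G S g) /\ forall m, wlen_le G S g m -> wlen G S g <= m.
Proof.
  intros [w [Hw He]]. unfold wlen. apply epsilon_spec.
  apply (nat_argmin nat (wlen_le G S g) (fun n => n)).
  exists (length w), w. auto.
Qed.

Lemma wlen_min (S : G -> Prop) (g : G) (m : nat) :
  wlen_le G S g m -> wlen G S g <= m.
Proof.
  intros Hm. apply wlen_spec; [|assumption].
  destruct Hm as (w & Hw & He & _). eauto.
Qed.

Lemma wlen_one (S : G -> Prop) : wlen G S gone = 0.
Proof.
  enough (wlen G S gone <= 0) by lia.
  apply wlen_min. exists []. split; [constructor|split; [reflexivity|apply le_n]].
Qed.

Lemma dist_refl (S : G -> Prop) (x : G) : dist G S x x = 0.
Proof. unfold dist. rewrite gmulVg. apply wlen_one. Qed.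

Lemma dist_mul_l (S : G -> Prop) (g x y : G) : dist G S (gmul g x) (gmul g y) = dist G S x y.
Proof. unfold dist. group_nf. reflexivity. Qed.

Lemma wlen_bounded_on_list (S : G -> Prop) (l : list G) :
  exists kappa, forall x, In x l -> wlen G S x <= kappa.
Proof.
  apply list_uniform_bound with (P := fun x k => wlen G S x <= k).
  - intros. lia.
  - intros x _. exists (wlen G S x). lia.
Qed.

Lemma dist_four_point (S : G -> Prop) (delta : nat) :
  (forall x y z w : G,
    (Z.min (gprod2 G S x y w) (gprod2 G S y z w) - 2 * Z.of_nat delta
       <= gprod2 G S x z w)%Z) ->
  forall x y z w, dist G S x z + dist G S y w
    <= Nat.max (dist G S x y + dist G S z w) (dist G S y z + dist G S x w)
       + 2 * delta.
Proof.
  intros Hhyp x y z w. specialize (Hhyp x y z w). unfold gprod2 in Hhyp. lia.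
Qed.

Section GeneratingSet.
Variable S : G -> Prop.
Hypothesis HS : gen_set G S.

Lemma wlen_attained (g : G) : wlen_le G S g (wlen G S g).
Proof. apply wlen_spec, HS. Qed.

Lemma wlen_mul (g h : G) : wlen G S (gmul g h) <= wlen G S g + wlen G S h.
Proof.
  destruct (wlen_attained g) as (v & Hv & Ev & Lv).
  destruct (wlen_attained h) as (w & Hw & Ew & Lw).
  apply wlen_min. exists (v ++ w). split; [|split].
  - apply Forall_app. split; assumption.
  - now rewrite eval_app, Ev, Ew.
  - rewrite length_app. lia.
Qed.

Lemma wlen_inv_le (g : G) : wlen G S (ginv g) <= wlen G S g.
Proof.
  destruct (wlen_attained g) as (w & Hw & Ew & Lw).
  apply wlen_min. exists (rev (map ginv w)). split; [|split].
  - apply Forall_rev, Forall_map. revert Hw. apply Forall_impl, HS.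
  - rewrite <- Ew. clear. induction w as [|x w IH]; simpl.
    + symmetry. apply ginv1.
    + rewrite eval_app, IH, ginvM. simpl. now rewrite gmulg1.
  - rewrite length_rev, length_map. assumption.
Qed.

Lemma dist_sym (x y : G) : dist G S x y = dist G S y x.
Proof.
  unfold dist.
  replace (gmul (ginv x) y) with (ginv (gmul (ginv y) x)) by (group_nf; reflexivity).
  pose proof (wlen_inv_le (gmul (ginv y) x)).
  pose proof (wlen_inv_le (ginv (gmul (ginv y) x))). rewrite ginvK in *. lia.
Qed.

Lemma dist_triangle (x y z : G) : dist G S x z <= dist G S x y + dist G S y z.
Proof.
  unfold dist.
  replace (gmul (ginv x) z) with (gmul (gmul (ginv x) y) (gmul (ginv y) z))
    by (group_nf; reflexivity).
  apply wlen_mul.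
Qed.

Lemma dist_geodesic (x y : G) (k : nat) : k <= dist G S x y ->
  exists m, dist G S x m = k /\ dist G S m y = dist G S x y - k.
Proof.
  intros Hk. destruct (wlen_attained (gmul (ginv x) y)) as (w & Hw & Ew & Lw).
  fold (dist G S x y) in Lw.
  exists (gmul x (eval G (firstn k w))).
  pose proof (dist_triangle x (gmul x (eval G (firstn k w))) y).
  assert (dist G S x (gmul x (eval G (firstn k w))) <= k).
  { unfold dist. rewrite gmulKg. apply wlen_min. exists (firstn k w).
    repeat split; [apply word_over_firstn; assumption|apply firstn_le_length]. }
  assert (dist G S (gmul x (eval G (firstn k w))) y <= dist G S x y - k); [|lia].
  unfold dist at 1. apply wlen_min. exists (skipn k w).
  split; [apply word_over_skipn; assumption|split].
  - rewrite ginvM, <- gmulA, <- Ew. rewrite <- (firstn_skipn k w) at 3.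
    rewrite eval_app, gmulKg. reflexivity.
  - rewrite length_skipn. lia.
Qed.

Lemma wlen_eval_le (T : G -> Prop) (kappa : nat) (w : list G) :
  (forall t, T t -> wlen G S t <= kappa) -> word_over G T w ->
  wlen G S (eval G w) <= kappa * length w.
Proof.
  intros HT. induction 1 as [|t w Ht _ IH]; simpl.
  - rewrite wlen_one. lia.
  - pose proof (wlen_mul t (eval G w)). specialize (HT t Ht). lia.
Qed.

(* Solutions [b], [b0] give [b b0^-1], which moves [b0] and [b0 w] by at most [2 r]. *)
Lemma acylindrical_finite (r R N : nat) :
  (forall x y : G, R <= dist G S x y -> forall l, NoDup l ->
     Forall (fun g => dist G S x (gmul g x) <= 2 * r /\
                      dist G S y (gmul g y) <= 2 * r) l -> length l <= N) ->
  forall a w, R <= wlen G S w ->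
  exists l, forall b, wlen G S b <= r /\ dist G S a (gmul b w) <= r -> In b l.
Proof.
  intros Hacyl a w Hw. apply finite_of_bounded_NoDup with (N := N).
  intros [|b0 l] Hnd Hl; [simpl; lia|].
  pose proof (Forall_inv Hl) as [Hb0 Hb0w].
  rewrite <- (length_map (fun b => gmul b (ginv b0))).
  apply (Hacyl b0 (gmul b0 w)).
  - unfold dist. now rewrite gmulKg.
  - apply NoDup_map_NoDup_ForallPairs; [|assumption].
    intros b b' _ _. apply gmul_cancel_r.
  - apply Forall_map. revert Hl. apply Forall_impl. intros b [Hb Hbw].
    replace (gmul (gmul b (ginv b0)) b0) with b by (group_nf; reflexivity).
    replace (gmul (gmul b (ginv b0)) (gmul b0 w)) with (gmul b w)
      by (group_nf; reflexivity).
    assert (Hone : forall g, dist G S gone g = wlen G S g)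
      by (intros; unfold dist; group_nf; reflexivity).
    pose proof (dist_triangle b0 gone b) as T1.
    pose proof (dist_triangle (gmul b0 w) a (gmul b w)) as T2.
    rewrite (dist_sym b0 gone), !Hone in T1. rewrite (dist_sym (gmul b0 w) a) in T2. lia.
Qed.

End GeneratingSet.

(** The chain runs through the prefixes of a shortest [S]-word. One half of the embedding inequality
    bounds their number, the other bounds a jump, of [S]-length at most 1, by [lam + c]. *)
Lemma qi_embedded_coarsely_embedded (Z H : G -> Prop) (S : list G) :
  subgroup G H -> fin_gen_subgroup G H S -> qi_embedded G H S Z ->
  exists lam c kappa, coarsely_embedded G (dist G Z) H lam c kappa.
Proof.
  intros (H1 & HM & HV) (HSH & _ & HSgen) (lam & c & Hqi).
  exists lam, c, (lam + c). intros h h' Hh Hh'.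
  destruct (wlen_spec _ _ (HSgen _ (HM _ _ (HV _ Hh) Hh'))) as [(w & Hw & Ew & Lw) _].
  fold (dist G (fun x => In x S) h h') in Lw.
  assert (HwH : forall v, word_over G (fun x => In x S) v -> H (eval G v)).
  { induction 1 as [|s v Hs _ IH]; simpl; [assumption|].
    apply HM; [apply HSH|]; assumption. }
  assert (HxH : forall i, H (gmul h (eval G (firstn i w)))).
  { intros i. apply HM; [assumption|]. apply HwH, word_over_firstn, Hw. }
  exists (length w), (fun i => gmul h (eval G (firstn i w))).
  split; [destruct (Hqi h h' Hh Hh'); lia|].
  split; [apply gmulg1|].
  split; [rewrite firstn_all, Ew; apply gmulKVg|].
  split; [assumption|]. intros i. cbv beta.
  destruct (Hqi _ _ (HxH i) (HxH (Datatypes.S i))) as [_ Hle].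
  assert (dist G (fun x => In x S) (gmul h (eval G (firstn i w)))
            (gmul h (eval G (firstn (Datatypes.S i) w))) <= 1); [|nia].
  unfold dist. rewrite <- Nat.add_1_r, eval_firstn_add. group_nf.
  apply wlen_min. exists (firstn 1 (skipn i w)).
  repeat split; [apply word_over_firstn, word_over_skipn, Hw|apply firstn_le_length].
Qed.

End WordMetric.

(** * Uniform bounds for conjugators *)

Lemma wlen_le_uniform (G : Group) (X : list G) (Q : G -> Prop) (l : list G) :
  gen_set G (fun x => In x X) -> (forall b, Q b -> In b l) ->
  exists K, forall b, Q b -> wlen_le G (fun x => In x X) b K.
Proof.
  intros HX Hl. destruct (wlen_bounded_on_list G (fun x => In x X) l) as [K HK].
  exists K. intros b Hb. apply (wlen_le_mono _ _ _ _ _ (HK b (Hl b Hb))).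
  apply wlen_attained, HX.
Qed.

Lemma short_words_conjugated (G : Group) (X : list G) (H : G -> Prop) (L : nat) :
  gen_set G (fun x => In x X) ->
  exists K, forall U, word_over G (fun x => In x X) U -> length U <= L ->
    (exists c, H (conj G c (eval G U))) ->
    exists c, wlen_le G (fun x => In x X) c K /\ H (conj G c (eval G U)).
Proof.
  intros HX. destruct (words_of_bounded_length G X L) as [l Hl].
  destruct (list_uniform_bound (list G) (fun U K =>
    (exists c, H (conj G c (eval G U))) ->
    exists c, wlen_le G (fun x => In x X) c K /\ H (conj G c (eval G U))) l)
    as [K HK].
  - intros U k k' Hk HU Hc. destruct (HU Hc) as [c [Hlen HHc]].
    exists c. split; [exact (wlen_le_mono _ _ _ _ _ Hk Hlen)|assumption].
  - intros U _.
    destruct (classic (exists c, H (conj G c (eval G U)))) as [[c Hc]|Hno].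
    + exists (wlen G (fun x => In x X) c). intros _. exists c.
      split; [apply wlen_attained, HX|assumption].
    + exists 0. intros Hc. contradiction.
  - exists K. intros U HU HL. apply HK, Hl; assumption.
Qed.

(** Bounded word lengths over finite alphabets leave finitely many pairs of [a] and [w], and
    acylindricity leaves finitely many [b] for each; [K] is the largest [X]-length that occurs. *)
Lemma acylindrical_uniform (G : Group) (X S : list G) (Z : G -> Prop) (r R N M W : nat) :
  gen_set G (fun x => In x X) -> gen_set G Z ->
  (forall x y : G, R <= dist G Z x y -> forall l, NoDup l ->
     Forall (fun g => dist G Z x (gmul g x) <= 2 * r /\
                      dist G Z y (gmul g y) <= 2 * r) l -> length l <= N) ->
  exists K, forall a w b,
    wlen_le G (fun x => In x S) a M -> wlen_le G (fun x => In x X) w W ->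
    R <= wlen G Z w -> wlen G Z b <= r -> dist G Z a (gmul b w) <= r ->
    wlen_le G (fun x => In x X) b K.
Proof.
  intros HX HZ Hacyl.
  destruct (words_of_bounded_length G S M) as [la Hla].
  destruct (words_of_bounded_length G X W) as [lw Hlw].
  destruct (list_uniform_bound (list G * list G) (fun aw K =>
    R <= wlen G Z (eval G (snd aw)) -> forall b, wlen G Z b <= r ->
    dist G Z (eval G (fst aw)) (gmul b (eval G (snd aw))) <= r ->
    wlen_le G (fun x => In x X) b K) (list_prod la lw)) as [K HK].
  - intros aw k k' Hk Haw HR b Hb Hd.
    exact (wlen_le_mono _ _ _ _ _ Hk (Haw HR b Hb Hd)).
  - intros [a w] _. simpl.
    destruct (le_lt_dec R (wlen G Z (eval G w))) as [HR|HR].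
    + destruct (acylindrical_finite G Z HZ r R N Hacyl (eval G a) (eval G w) HR)
        as [l Hl].
      destruct (wlen_le_uniform G X _ l HX Hl) as [K HK].
      exists K. auto.
    + exists 0. intros. lia.
  - exists K. intros a w b (va & Hva & <- & La) (vw & Hvw & <- & Lw) HR Hb Hd.
    apply (HK (va, vw)); auto. apply in_prod; auto.
Qed.

(** * Bounded conjugators into [H] *)

Theorem theorem6p1 (G : Group) (X : list G) (Z : G -> Prop) (H : G -> Prop)
  (HX : gen_set G (fun x => In x X))
  (HZ : gen_set G Z)
  (HH : subgroup G H)
  (HHfg : exists S : list G, fin_gen_subgroup G H S /\ qi_embedded G H S Z)
  (Hacyl : acylindrical G Z)
  (Hhyp : cayley_hyperbolic G Z) :
  BCD_rel G X H.
Proof.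
  destruct HHfg as (S & HS & Hqi). destruct Hhyp as [delta Hdelta].
  pose proof (dist_four_point G Z delta Hdelta) as Hfour.
  pose proof (dist_refl G Z) as Hrefl.
  pose proof (dist_sym G Z HZ) as Hsym.
  pose proof (dist_triangle G Z HZ) as Htri.
  pose proof (dist_geodesic G Z HZ) as Hgeod.
  pose proof (dist_mul_l G Z) as Hinv.
  assert (HHne : exists h, H h) by (exists gone; apply HH).
  destruct (qi_embedded_coarsely_embedded G Z H S HH HS Hqi)
    as (lam0 & c0 & kappa0 & Hemb).
  destruct (coarsely_embedded_contracting G (dist G Z) delta Hrefl Hsym Htri Hgeod
              Hfour H HHne lam0 c0 kappa0 Hemb) as [B HB].
  destruct Hqi as (lam & c & Hqi).
  destruct (wlen_bounded_on_list G Z X) as [kappa Hkappa].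
  destruct (wlen_bounded_on_list G (fun x => In x X) S) as [C HC].
  destruct (fast_path_comes_close G (dist G Z) Hrefl Htri H B kappa (C * (lam + 1)) HB)
    as [r Hfast].
  destruct (Hacyl (2 * r)) as (R & N & HRN).
  (* Projections more than [R + 2 * r] apart force the two [r]-close path points at least [R] apart,
     as acylindricity requires. *)
  destruct (Hfast (R + 2 * r) (B + c)) as (W & L0 & Hclose).
  destruct (short_words_conjugated G X H L0 HX) as [K1 HK1].
  destruct (acylindrical_uniform G X S Z r R N (lam * (2 * r + kappa * W) + c) W
              HX HZ HRN) as [K2 HK2].
  exists (Nat.max K1 K2). intros U HU HUmin HUH.
  destruct (le_lt_dec (length U) L0) as [HL|HL].
  { destruct (HK1 U HU HL HUH) as [g [Hg HgH]]. exists g, U.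
    split; [apply (wlen_le_mono _ _ _ K1); [lia|assumption]|].
    split; [|assumption]. exists 0. simpl. now rewrite app_nil_r. }
  destruct HUH as [g0 Hg0]. set (h := conj G g0 (eval G U)) in *.
  destruct HH as (H1 & HM & HV). destruct HS as (HSH & _ & HSgen).
  (* Past [length U] the path is constant, so the step bound holds at every index. *)
  set (y := fun i => gmul g0 (eval G (firstn i U))).
  assert (Hyy : forall i n, gmul (ginv (y i)) (y (i + n)) = eval G (firstn n (skipn i U))).
  { intros i n. unfold y. rewrite eval_firstn_add. group_nf. reflexivity. }
  assert (Hxx : forall i n, wlen_le G (fun x => In x X) (gmul (ginv (y i)) (y (i + n))) n).
  { intros i n. exists (firstn n (skipn i U)).
    split; [apply word_over_firstn, word_over_skipn, HU|].
    split; [symmetry; apply Hyy|apply firstn_le_length]. }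
  assert (Hydist : forall i n, dist G Z (y i) (y (i + n)) <= kappa * n).
  { intros i n. destruct (Hxx i n) as (w & Hw & Ew & Lw).
    unfold dist. rewrite <- Ew.
    pose proof (wlen_eval_le G Z HZ (fun x => In x X) kappa w Hkappa Hw). nia. }
  assert (Hystep : forall i, dist G Z (y i) (y (Datatypes.S i)) <= kappa).
  { intros i. pose proof (Hydist i 1) as Hd. rewrite Nat.add_1_r in Hd. lia. }
  pose (pr := fun x => constructive_indefinite_description _
                         (nearest_exists G (dist G Z) H HHne x)).
  set (p := fun i => proj1_sig (pr (y i))).
  assert (Hp : forall i, nearest G (dist G Z) H (y i) (p i))
    by (intros i; exact (proj2_sig (pr (y i)))).
  assert (HpH : forall i, H (p i)) by (intros; apply Hp).
  assert (Hend : y (length U) = gmul h (y 0)).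
  { unfold y, h, conj. rewrite firstn_all. simpl. group_nf. reflexivity. }
  (* The chosen projections need not be equivariant under [h], but [h p_0] is also nearest to the
     endpoint, and contraction puts it within [B] of the chosen one. *)
  assert (Hnear_end : nearest G (dist G Z) H (y (length U)) (gmul h (p 0))).
  { split; [apply HM; [exact Hg0|apply HpH]|]. intros k Hk.
    rewrite Hend, Hinv. rewrite <- (gmulKVg _ h k), Hinv.
    apply Hp, HM; [apply HV, Hg0|exact Hk]. }
  (* Minimality gives [length U <= |h'|_X <= C * |h'|_S], and the embedding bounds [|h'|_S] by
     [lam * d1 + c]; the factor [lam + 1] absorbs [c]. *)
  assert (Hlong : length U <= C * (lam + 1) * (dist G Z (p 0) (p (length U)) + (B + c))).
  { set (h' := gmul (ginv (p 0)) (gmul h (p 0))).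
    assert (Hh' : H h') by (apply HM; [apply HV, HpH|apply HM; [exact Hg0|apply HpH]]).
    destruct (wlen_spec G _ _ (HSgen _ Hh')) as [(w & Hw & Ew & Lw) _].
    pose proof (wlen_eval_le G _ HX (fun x => In x S) C w HC Hw) as HCw.
    rewrite Ew in HCw.
    destruct (wlen_attained G _ HX h') as (V & HVX & EV & LV).
    assert (HUV : length U <= length V).
    { apply HUmin; [exact HVX|]. exists (gmul (ginv (p 0)) g0).
      rewrite EV. unfold h', h, conj. group_nf. reflexivity. }
    destruct (Hqi (p 0) (gmul h (p 0)) (HpH 0)) as [Hle _];
      [apply HM; [exact Hg0|apply HpH]|].
    unfold dist at 1 in Hle. fold h' in Hle.
    pose proof (HB _ _ _ _ (Hp (length U)) Hnear_end) as Hcl.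
    pose proof (Htri (p 0) (p (length U)) (gmul h (p 0))).
    rewrite Hrefl in Hcl.
    set (d1 := dist G Z (p 0) (gmul h (p 0))) in *.
    set (d2 := dist G Z (p 0) (p (length U))) in *.
    assert (d1 <= d2 + B) by lia.
    assert (length w <= (lam + 1) * (d2 + (B + c))) by nia.
    nia. }
  destruct (Hclose y p Hystep Hp (length U) HL Hlong) as (i & j & [Hij HjW] & Hi & Hj & Hfar).
  set (n := j - i) in *. assert (Hjn : j = i + n) by lia.
  set (b := gmul (ginv (p i)) (y i)).
  exists b, (skipn i U ++ firstn i U).
  split; [|split; [exists i; reflexivity|]].
  - apply (wlen_le_mono _ _ _ K2); [lia|].
    pose proof (Hydist i n) as Hyij. rewrite <- Hjn in Hyij.
    pose proof (Htri (p i) (y i) (p j)) as T1.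
    pose proof (Htri (y i) (y j) (p j)) as T2.
    rewrite (Hsym (p i) (y i)) in T1.
    assert (kappa * n <= kappa * W) by (apply Nat.mul_le_mono_l; lia).
    (* Translating by [p_i^-1] turns the closeness of [y_j] to [p_j] into that of [b w] to [a], with
       [w = y_i^-1 y_j] and [a = p_i^-1 p_j]. *)
    apply (HK2 (gmul (ginv (p i)) (p j)) (gmul (ginv (y i)) (y j))).
    + assert (Hpp : H (gmul (ginv (p i)) (p j))) by (apply HM; [apply HV|]; apply HpH).
      destruct (wlen_spec G _ _ (HSgen _ Hpp)) as [Hw _].
      refine (wlen_le_mono _ _ _ _ _ _ Hw).
      destruct (Hqi (p i) (p j) (HpH i) (HpH j)) as [Hle _].
      unfold dist at 1 in Hle. apply (Nat.le_trans _ _ _ Hle).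
      apply Nat.add_le_mono_r, Nat.mul_le_mono_l. lia.
    + rewrite Hjn. apply (wlen_le_mono _ _ _ n); [lia|apply Hxx].
    + fold (dist G Z (y i) (y j)). lia.
    + unfold b. fold (dist G Z (p i) (y i)). rewrite Hsym. exact Hi.
    + unfold b. rewrite <- gmulA, gmulKVg, Hinv, Hsym. exact Hj.
  (* Conjugating the rotated word by [y_i] gives [h], so conjugating it by [b] gives [p_i^-1 h p_i],
     a product of elements of [H]. *)
  - replace (conj G b (eval G (skipn i U ++ firstn i U)))
      with (gmul (gmul (ginv (p i)) h) (p i)).
    { apply HM; [apply HM; [apply HV, HpH|exact Hg0]|apply HpH]. }
    assert (Hrot : eval G (skipn i U ++ firstn i U)
      = gmul (ginv (eval G (firstn i U))) (gmul (eval G U) (eval G (firstn i U)))).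
    { rewrite <- eval_rotation. symmetry. apply gmulKg. }
    rewrite Hrot. unfold b, y, h, conj. group_nf. reflexivity.
Qed.
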